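(* Let $R$ be a commutative ring with unit and let $\varphi:\vec G\to\vec G'$ be a strong totally geodesic immersion of digraphs with radius $m_0/2$ (resp. a strong totally geodesic embedding of digraphs). Then $\varphi$ induces, via $(v_1,\ldots,v_k)\mapsto(\varphi(v_1),\ldots,\varphi(v_k))$, a family of double-persistent $\mathbb Z_2$-equivariant isometric embeddings $$\overrightarrow{\mathrm{Conf}}_k(\vec G,\tfrac n2,\tfrac m2)\longrightarrow\overrightarrow{\mathrm{Conf}}_k(\vec G',\tfrac n2,\tfrac m2),\qquad k\ge1,$$ for all $1\le n<m\le m_0$ (resp. for all $1\le n<m\le\infty$), and thereby induces a double-persistent $\mathbb Z_2$-equivariant homomorphism $$H_*(\mathcal D(\vec G,\tfrac n2,\tfrac m2))\longrightarrow H_*(\mathcal D(\vec G',\tfrac n2,\tfrac m2))$$ for all $1\le n<m\le m_0$ (resp. for all $1\le n<m\le\infty$), where $n/2$ is the first parameter and $m/2$ the second parameter in the double-persistence.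
   Context: A digraph $\vec G=(V_{\vec G},E_{\vec G})$ consists of a set of vertices and a set $E_{\vec G}$ of ordered pairs of distinct vertices (arcs). A morphism of digraphs $\varphi:\vec G\to\vec G'$ is a map $V_{\vec G}\to V_{\vec G'}$ such that for every arc $(u,v)$ of $\vec G$ either $(\varphi(u),\varphi(v))$ is an arc of $\vec G'$ or $\varphi(u)=\varphi(v)$. The distance $d_{\vec G}(u,v)\in\mathbb N\cup\{\infty\}$ is the smallest $n$ for which there is a sequence $v_0\ldots v_n$ of vertices, from $u$ to $v$ or from $v$ to $u$, with $(v_{j-1},v_j)\in E_{\vec G}$ or $v_{j-1}=v_j$ for each $j$; it is $\infty$ if there is none. A morphism $\varphi$ is a strong totally geodesic embedding if $d_{\vec G}(u,v)=d_{\vec G'}(\varphi(u),\varphi(v))$ for all $u,v\in V_{\vec G}$; it is a strong totally geodesic immersion with radius $m_0/2$ ($m_0\in\mathbb N$) if this equality holds for all $u,v$ with $d_{\vec G}(u,v)\le m_0$. For $1\le n<m\le\infty$, $$\overrightarrow{\mathrm{Conf}}_k(\vec G,\tfrac n2,\tfrac m2)=\{(v_1,\ldots,v_k)\in V_{\vec G}^k: n<d_{\vec G}(v_i,v_{i+1})\le m\text{ for }1\le i\le k-1\}$$ (if $m=\infty$ the upper constraint is vacuous), with product distance $(d_{\vec G})^k((u_i),(v_i))=\max_i d_{\vec G}(u_i,v_i)$. The nontrivial element of $\mathbb Z_2$ acts by reversing tuples. Isometric embedding means injective distance-preserving map. ''Double-persistent'' means commuting with the canonical inclusions obtained by decreasing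 $n$ and increasing $m$ (and with the maps these induce on homology). Chain complexes: an elementary $q$-path on a set $V$ is a sequence $v_0\ldots v_q$ in $V$; it is regular if $v_{i-1}\ne v_i$ for all $1\le i\le q$. $\Lambda_q(V)$ is the free $R$-module on elementary $q$-paths, with $\partial(v_0\ldots v_q)=\sum_{i=0}^q(-1)^iv_0\ldots\widehat{v_i}\ldots v_q$; the non-regular paths span a subcomplex $I_*(V)$, and $\mathcal R_*(V)=\Lambda_*(V)/I_*(V)$ is the quotient complex, with basis the regular paths. $\mathcal D_k(\vec G,\frac n2,\frac m2)$ is the free $R$-module on $\overrightarrow{\mathrm{Conf}}_k(\vec G,\frac n2,\frac m2)$, a $k$-tuple being regarded as a (regular) elementary $(k-1)$-path, and $\mathcal D(\vec G,\frac n2,\frac m2)=\bigoplus_{k\ge1}\mathcal D_k(\vec G,\frac n2,\frac m2)$ is regarded as a graded submodule of $\mathcal R_*(V_{\vec G})$. For a graded submodule $D$ of a chain complex $(C,\partial)$, $\mathrm{Inf}_q(D)=D_q\cap\partial^{-1}D_{q-1}$ and $\mathrm{Sup}_q(D)=D_q+\partial D_{q+1}$ are subcomplexes of $C$, the inclusion $\mathrm{Inf}(D)\to\mathrm{Sup}(D)$ is a quasi-isomorphism, and $H_*(D)$ denotes $H_*(\mathrm{Inf}(D))\cong H_*(\mathrm{Sup}(D))$. The $\mathbb Z_2$-action on $H_*(\mathcal D)$ is induced by reversing paths; the homomorphism on $H_*(\mathcal D)$ is obtained by $R$-linear extension of the map on tuples and restriction to $\mathrm{Inf}$.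
   Formalization: For an immersion of radius m_0/2, the maps on configuration spaces are shown injective and distance-preserving only for pairs of tuples at distance at most m_0; the full isometric embedding claim fails, e.g. for two isolated vertices mapped to a single vertex (k=1). *)

(* Defs.v *)
From HB Require Import structures.
From mathcomp Require Import all_boot all_order all_algebra.
From mathcomp Require Import finmap boolp monalg.
From mathcomp Require Import zify.

Set Implicit Arguments.
Unset Strict Implicit.
Unset Printing Implicit Defensive.

Import GRing.Theory.
Local Open Scope ring_scope.
Local Open Scope quotient_scope.

(* -------------------------------------------------------------------- *)
Record submodule (R : pzRingType) (M : lmodType R) := Submodule {
  smem : {pred M};
  smemP : submod_closed smem }.

HB.instance Definition _ (R : pzRingType) (M : lmodType R) (N : submodule M) :=
  GRing.isSubmodClosed.Build R M (smem N) (smemP N).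

Section SubmoduleType.
Variables (R : pzRingType) (M : lmodType R) (N : submodule M).

Record subm : predArgType := Subm { subm_val : M; _ : subm_val \in smem N }.

HB.instance Definition _ := [isSub for subm_val].
HB.instance Definition _ := [Choice of subm by <:].
HB.instance Definition _ := [SubChoice_isSubLmodule of subm by <:].
End SubmoduleType.

Section QuotientModule.
Variables (R : pzRingType) (M : lmodType R) (N : submodule M).

Definition quotm : Type := Quotient.quot (smem N).
HB.instance Definition _ := GRing.Zmodule.on quotm.

Definition qpi (x : M) : quotm := \pi_(Quotient.quot (smem N)) x.
Definition qrepr (x : quotm) : M := repr (x : Quotient.quot (smem N)).

Lemma qpiK x : qpi (qrepr x) = x. Proof. exact: reprK. Qed.

Lemma qpiP x y : reflect (qpi x = qpi y) (x - y \in smem N).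
Proof. by rewrite Quotient.idealrBE; apply: eqP. Qed.

Lemma qreprK x : x - qrepr (qpi x) \in smem N.
Proof. by apply/qpiP; rewrite qpiK. Qed.

Fact qpi_zmod_morphism : zmod_morphism qpi.
Proof. by move=> x y; rewrite /qpi raddfB. Qed.

HB.instance Definition _ :=
  GRing.isZmodMorphism.Build M quotm qpi qpi_zmod_morphism.

Definition qscale (a : R) (x : quotm) : quotm := qpi (a *: qrepr x).

Lemma qscale_pi a x : qscale a (qpi x) = qpi (a *: x).
Proof. by apply/qpiP; rewrite -scalerBr -rpredN -scalerN opprB rpredZ ?qreprK. Qed.

Fact qscaleA a b x : qscale a (qscale b x) = qscale (a * b) x.
Proof. by rewrite -(qpiK x) !qscale_pi scalerA. Qed.
Fact qscale1 : left_id 1 qscale.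
Proof. by move=> x; rewrite -(qpiK x) !qscale_pi scale1r. Qed.
Fact qscaleDr : right_distributive qscale +%R.
Proof.
by move=> a x y; rewrite -(qpiK x) -(qpiK y) -raddfD !qscale_pi scalerDr raddfD.
Qed.
Fact qscaleDl x : {morph qscale^~ x : a b / a + b}.
Proof. by move=> a b; rewrite -(qpiK x) !qscale_pi scalerDl raddfD. Qed.

HB.instance Definition _ := GRing.Zmodule_isLmodule.Build R quotm
  qscaleA qscale1 qscaleDr qscaleDl.

Fact qpi_scalable : scalable qpi.
Proof. by move=> a x; rewrite -qscale_pi. Qed.
HB.instance Definition _ := GRing.isScalable.Build R M quotm *:%R qpi qpi_scalable.

Variables (M' : lmodType R) (f : {linear M -> M'}).
Definition qlift (hf : forall x, x \in smem N -> f x = 0) (x : quotm) : M' :=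
  f (qrepr x).

Hypothesis hf : forall x, x \in smem N -> f x = 0.

Lemma qlift_pi x : qlift hf (qpi x) = f x.
Proof. by have := hf (qreprK x); rewrite linearB => /subr0_eq/esym. Qed.

Fact qlift_linear : linear (qlift hf).
Proof.
move=> a x y; rewrite -(qpiK x) -(qpiK y) -linearZ -linearD /= !qlift_pi.
exact: linearP.
Qed.
HB.instance Definition _ :=
  GRing.isLinear.Build R quotm M' *:%R (qlift hf) qlift_linear.
End QuotientModule.

(* -------------------------------------------------------------------- *)
(* monalg only makes {malg R[K]} an lmodType for a nonzero ring R; the alias
   extends this to every comPzRingType. *)
Definition freemod (R : comPzRingType) (K : choiceType) : Type := {malg R[K]}.
HB.instance Definition _ (R : comPzRingType) (K : choiceType) :=
  GRing.Zmodule.on (freemod R K).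

Section FreeModule.
Variables (R : comPzRingType) (K : choiceType).
Implicit Types (a : R) (c : freemod R K).

Definition fscale a c : freemod R K := [malg k in msupp c => a * c@_k].

Lemma fscaleE a c k : (fscale a c)@_k = a * c@_k.
Proof. by rewrite mcoeffE; case: msuppP; rewrite ?mulr0. Qed.

Fact fscaleA a b c : fscale a (fscale b c) = fscale (a * b) c.
Proof. by apply/malgP => k; rewrite !fscaleE mulrA. Qed.
Fact fscale1 : left_id 1 fscale.
Proof. by move=> c; apply/malgP => k; rewrite fscaleE mul1r. Qed.
Fact fscaleDr : right_distributive fscale +%R.
Proof.
by move=> a c d; apply/malgP => k; rewrite !(fscaleE, mcoeffD) mulrDr.
Qed.
Fact fscaleDl c : {morph fscale^~ c : a b / a + b}.
Proof.
by move=> a b; apply/malgP => k; rewrite !(fscaleE, mcoeffD) mulrDl.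
Qed.

HB.instance Definition _ := GRing.Zmodule_isLmodule.Build R (freemod R K)
  fscaleA fscale1 fscaleDr fscaleDl.

Definition fbasis (k : K) : freemod R K := << k >>.

Lemma fcoefZ a c k : (a *: c)@_k = a * c@_k.
Proof. exact: fscaleE. Qed.

Lemma fbasisE k k' : (fbasis k)@_k' = (k == k')%:R.
Proof. by rewrite mcoeffU. Qed.

Variable M : lmodType R.

Definition linext (f : K -> M) (c : freemod R K) : M :=
  \sum_(k <- msupp c) c@_k *: f k.

Lemma linextw f c (d : {fset K}) : (msupp c `<=` d)%fset ->
  linext f c = \sum_(k <- d) c@_k *: f k.
Proof.
move=> cd; rewrite /linext (big_fset_incl _ cd) //= => k _ /mcoeff_outdom ->.
by rewrite scale0r.
Qed.

Fact linext_linear f : linear (linext f).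
Proof.
move=> a c d; pose D := (msupp c `|` msupp d `|` msupp (a *: c + d))%fset.
rewrite !(@linextw f _ D) /D ?fsubsetUr //; first last.
- by rewrite -fsetUA fsubsetUl.
- by rewrite fsetUAC fsubsetUr.
rewrite scaler_sumr -big_split /=; apply: eq_bigr => k _.
by rewrite mcoeffD fcoefZ scalerDl scalerA.
Qed.
HB.instance Definition _ f :=
  GRing.isLinear.Build R (freemod R K) M *:%R (linext f) (linext_linear f).

Lemma linext_basis f k : linext f (fbasis k) = f k.
Proof.
rewrite (@linextw f _ [fset k]%fset) ?msuppU_le //.
by rewrite big_seq_fset1 fbasisE eqxx scale1r.
Qed.

Lemma fbasis_decomp c : c = \sum_(k <- msupp c) c@_k *: fbasis k.
Proof.
rewrite {1}[c]monalgE; apply: eq_bigr => k _; apply/malgP => k'.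
by rewrite fcoefZ fbasisE mcoeffU mulr_natr.
Qed.
End FreeModule.

Lemma eq_linear_basis (R : comPzRingType) (K : choiceType) (M : lmodType R)
    (f g : {linear freemod R K -> M}) :
  (forall k, f (fbasis R k) = g (fbasis R k)) -> f =1 g.
Proof.
move=> fg c; rewrite (fbasis_decomp c) !linear_sum; apply: eq_bigr => k _.
by rewrite !linearZ /= fg.
Qed.

(* -------------------------------------------------------------------- *)
(* Complexes are indexed by nat: the boundary out of degree 0, which lands in
   degree 0.-1 = 0, is required to vanish. *)
Record chain_complex (R : pzRingType) := ChainComplex {
  cobj :> nat -> lmodType R;
  bd : forall q, {linear cobj q -> cobj q.-1};
  bd0 : forall x, bd 0 x = 0;
  bdK : forall q x, bd q.-1 (bd q x) = 0 }.
Arguments bd {R} c q.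

Section Homology.
Variables (R : pzRingType) (C : chain_complex R) (q : nat).

Fact cycles_closed : submod_closed [pred x : C q | bd C q x == 0].
Proof.
split=> [|a x y]; rewrite !inE ?linear0 // linearP.
by move=> /eqP-> /eqP->; rewrite scaler0 addr0.
Qed.
Definition cycles : submodule (C q) := Submodule cycles_closed.

Fact boundaries_closed :
  submod_closed [pred z : subm cycles | `[< exists y, bd C q.+1 y = val z >]].
Proof.
split=> [|a z t]; rewrite !inE.
  by apply/asboolP; exists 0; rewrite linear0.
move=> /asboolP[y yz] /asboolP[w wt]; apply/asboolP; exists (a *: y + w).
by rewrite linearP /= yz wt.
Qed.
Definition boundaries : submodule (subm cycles) := Submodule boundaries_closed.

Definition homology : lmodType R := quotm boundaries.
Definition hclass (z : subm cycles) : homology := qpi boundaries z.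
End Homology.

(* With csign = fun=> 0 these are the chain maps; the sign is needed because
   the reversal of paths commutes with the boundary only up to sign. *)
Record signed_chain_map (R : pzRingType) (C C' : chain_complex R) :=
  SignedChainMap {
    cmap :> forall q, {linear C q -> C' q};
    csign : nat -> nat;
    cmapP : forall q x, bd C' q (cmap q x) = (-1) ^+ csign q *: cmap q.-1 (bd C q x) }.

Section InducedMap.
Variables (R : pzRingType) (C C' : chain_complex R) (f : signed_chain_map C C').
Variable q : nat.

Fact cyc_map_subproof (z : subm (cycles C q)) : f q (val z) \in smem (cycles C' q).
Proof.
by case: z => z /= zP; rewrite inE cmapP (eqP zP) linear0 scaler0.
Qed.
Definition cyc_map (z : subm (cycles C q)) : subm (cycles C' q) :=
  Subm (cyc_map_subproof z).

Fact cyc_map_linear : linear cyc_map.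
Proof. by move=> a x y; apply: val_inj; rewrite /= !linearP. Qed.
HB.instance Definition _ := GRing.isLinear.Build R _ _ *:%R cyc_map cyc_map_linear.

Definition cyc_class (z : subm (cycles C q)) : homology C' q := hclass (cyc_map z).
Fact cyc_class_linear : linear cyc_class.
Proof. by move=> a x y; rewrite /cyc_class /hclass !linearP. Qed.
HB.instance Definition _ :=
  GRing.isLinear.Build R _ (homology C' q) *:%R cyc_class cyc_class_linear.

Fact cyc_class_boundary z : z \in smem (boundaries C q) -> cyc_class z = 0.
Proof.
rewrite inE => /asboolP[y yz]; rewrite -[RHS](raddf0 (qpi (boundaries C' q))).
apply/qpiP; rewrite subr0 inE; apply/asboolP.
exists ((-1) ^+ csign f q.+1 *: f q.+1 y).
by rewrite linearZ /= cmapP /= scalerA -expr2 sqrr_sign scale1r yz.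
Qed.

Definition hmap : {linear homology C q -> homology C' q} :=
  qlift cyc_class_boundary.

Lemma hmap_class z : hmap (hclass z) = hclass (cyc_map z).
Proof. exact: (qlift_pi cyc_class_boundary). Qed.
End InducedMap.

(* -------------------------------------------------------------------- *)
Definition graded_submodule (R : pzRingType) (C : chain_complex R) :=
  forall q, submodule (C q).

Section Inf.
Variables (R : pzRingType) (C : chain_complex R) (D : graded_submodule C).

Fact inf_closed q :
  submod_closed [pred x : C q | (x \in smem (D q)) && (bd C q x \in smem (D q.-1))].
Proof.
split=> [|a x y]; rewrite !inE ?linear0 ?rpred0 // linearP /=.
by move=> /andP[xD xD'] /andP[yD yD']; rewrite !rpredD ?rpredZ.
Qed.
Definition inf_sub q : submodule (C q) := Submodule (inf_closed q).

Fact inf_bd_subproof q (x : subm (inf_sub q)) :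
  bd C q (val x) \in smem (inf_sub q.-1).
Proof. by case: x => x /= /andP[_ xD]; rewrite inE xD bdK rpred0. Qed.
Definition inf_bd q (x : subm (inf_sub q)) : subm (inf_sub q.-1) :=
  Subm (inf_bd_subproof x).
Fact inf_bd_linear q : linear (@inf_bd q).
Proof. by move=> a x y; apply: val_inj; rewrite /= !linearP. Qed.
HB.instance Definition _ q :=
  GRing.isLinear.Build R _ _ *:%R (@inf_bd q) (@inf_bd_linear q).

Fact inf_bd0 (x : subm (inf_sub 0)) : inf_bd x = 0.
Proof. by apply: val_inj; rewrite /= bd0. Qed.
Fact inf_bdK q (x : subm (inf_sub q)) : inf_bd (inf_bd x) = 0.
Proof. by apply: val_inj; rewrite /= bdK. Qed.

Definition Inf : chain_complex R :=
  @ChainComplex R (fun q => subm (inf_sub q)) (fun q => @inf_bd q) inf_bd0 inf_bdK.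
End Inf.

Section InfMap.
Variables (R : pzRingType) (C C' : chain_complex R).
Variables (D : graded_submodule C) (D' : graded_submodule C').
Variable f : signed_chain_map C C'.
Hypothesis fD : forall q x, x \in smem (D q) -> f q x \in smem (D' q).

Fact inf_cmap_subproof q (x : Inf D q) : f q (val x) \in smem (inf_sub D' q).
Proof.
by case: x => x /= /andP[xD xD']; rewrite inE fD //= cmapP rpredZ // fD.
Qed.
Definition inf_cmap q (x : Inf D q) : Inf D' q := Subm (inf_cmap_subproof x).
Fact inf_cmap_linear q : linear (@inf_cmap q).
Proof. by move=> a x y; apply: val_inj; rewrite /= !linearP. Qed.
HB.instance Definition _ q :=
  GRing.isLinear.Build R _ _ *:%R (@inf_cmap q) (@inf_cmap_linear q).

Fact inf_cmapP q x :
  bd (Inf D') q (inf_cmap x) = (-1) ^+ csign f q *: inf_cmap (bd (Inf D) q x).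
Proof. by apply: val_inj; rewrite /= cmapP. Qed.

Definition inf_map : signed_chain_map (Inf D) (Inf D') :=
  @SignedChainMap R (Inf D) (Inf D') (fun q => @inf_cmap q) (csign f) inf_cmapP.
End InfMap.

(* -------------------------------------------------------------------- *)
Lemma linext_mem (R : comPzRingType) (K : choiceType) (M : lmodType R)
    (N : submodule M) (g : K -> M) c :
  (forall k, k \in msupp c -> g k \in smem N) -> linext g c \in smem N.
Proof.
by move=> gN; rewrite /linext big_seq rpred_sum // => k /gN; apply: rpredZ.
Qed.

Lemma submodule_sum (R : pzRingType) (M : lmodType R) (N : submodule M)
    (I : Type) (r : seq I) (P : pred I) (F : I -> M) :
  (forall i, P i -> F i \in smem N) -> \sum_(i <- r | P i) F i \in smem N.
Proof. by move=> FN; apply: rpred_sum. Qed.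

Section PathComplex.
Variables (R : comPzRingType) (V : choiceType).
Implicit Types (q : nat).

Definition Lambda q := freemod R (q.+1.-tuple V).

Definition face q (t : q.+2.-tuple V) (i : 'I_q.+2) : q.+1.-tuple V :=
  [tuple tnth t (lift i j) | j < q.+1].

Definition epath_bd q : q.+1.-tuple V -> Lambda q.-1 :=
  match q with
  | 0 => fun=> 0
  | p.+1 => fun t => \sum_(i < p.+2) (-1) ^+ i *: fbasis R (face t i)
  end.

Definition Lambda_bd q : {linear Lambda q -> Lambda q.-1} := linext (@epath_bd q).

Definition regular q (t : q.-tuple V) : bool := sorted (fun x y => x != y) t.

Fact nonreg_closed q :
  submod_closed [pred c : Lambda q | all (fun t => ~~ regular t) (msupp c)].
Proof.
have nonregP (c : Lambda q) :
    reflect (forall t, regular t -> c@_t = 0) (all (fun t => ~~ regular t) (msupp c)).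
  apply: (iffP allP) => [cP t tr|cP t]; last first.
    by rewrite -mcoeff_neq0; apply: contra => /cP->.
  by apply/eqP; rewrite mcoeff_eq0; apply/negP => /cP; rewrite tr.
split=> [|a c d]; rewrite !inE; first by apply/nonregP => t _; rewrite mcoeff0.
move=> /nonregP cP /nonregP dP; apply/nonregP => t tr.
by rewrite mcoeffD fcoefZ cP ?dP // mulr0 addr0.
Qed.
Definition nonreg q : submodule (Lambda q) := Submodule (@nonreg_closed q).
Arguments nonreg : simpl never.

Lemma nonreg_basis q (t : q.+1.-tuple V) :
  ~~ regular t -> fbasis R t \in smem (nonreg q).
Proof.
move=> tN; apply/allP => u /(fsubsetP msuppU_le); rewrite in_fset1 => /eqP->.
exact: tN.
Qed.

Lemma nth_face x0 q (t : q.+2.-tuple V) i k :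
  (k < q.+1)%N -> nth x0 (face t i) k = nth x0 t (bump i k).
Proof.
move=> kq; have -> : k = Ordinal kq by [].
by rewrite -tnth_nth tnth_mktuple (tnth_nth x0).
Qed.

Lemma eq_face q (t u : q.+1.-tuple V) x0 :
  (forall k, (k < q.+1)%N -> nth x0 t k = nth x0 u k) -> t = u.
Proof.
move=> tu; apply/val_inj/(@eq_from_nth _ x0); rewrite ?size_tuple //.
Qed.

Lemma epath_bd_nonreg q (t : q.+1.-tuple V) :
  ~~ regular t -> epath_bd t \in smem (nonreg q.-1).
Proof.
case: q t => [|q] t tN; first exact: rpred0.
have x0 := thead t.
have [i iq /eqP ti] : exists2 i, (i.+1 < q.+2)%N & nth x0 t i == nth x0 t i.+1.
  apply/exists2P/not_existsP => H; case/negP: tN; apply/(sortedP x0) => i.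
  by rewrite size_tuple => iq; apply/negP => e; apply: (H i).
have iq' := ltnW iq.
rewrite /= (bigD1 (Ordinal iq')) //= (bigD1 (Ordinal iq)) /=; last first.
  by rewrite -val_eqE /= gtn_eqF.
have -> : face t (Ordinal iq) = face t (Ordinal iq').
  apply: (@eq_face _ _ _ x0) => k kq; rewrite !nth_face //= /bump.
  by case: (ltngtP i k) => [//|//|<-]; rewrite add0n add1n ti.
rewrite addrA exprS mulN1r scaleNr subrr add0r.
apply: (@submodule_sum _ _ (nonreg q)) => j /andP[]; rewrite -!val_eqE /= => ji ji1.
apply: (rpredZ (s := smem (nonreg q))); apply: nonreg_basis.
apply/negP => /(sortedP x0) H.
have [jlt|jgt] := ltnP j i.
  have i_gt0 : (0 < i)%N by apply: leq_ltn_trans jlt.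
  have := H i.-1; rewrite size_tuple prednK // => /(_ iq).
  rewrite !nth_face // 1?(leq_ltn_trans (leq_pred _)) // /bump.
  rewrite (ltnW jlt) -ltnS prednK // jlt !add1n prednK // ti eqxx.
  exact: notF.
have {}jgt : (i.+1 < j)%N.
  by rewrite ltn_neqAle eq_sym ji1 ltn_neqAle eq_sym ji.
have iq2 : (i.+1 < q.+1)%N by apply: leq_trans jgt (ltn_ord j).
have := H i; rewrite size_tuple => /(_ iq2).
rewrite !nth_face // 1?ltnW // /bump leqNgt (ltnW jgt) leqNgt jgt /= !add0n ti eqxx.
exact: notF.
Qed.

Lemma face_face q (t : q.+3.-tuple V) (i : 'I_q.+3) (j : 'I_q.+2)
    (i' : 'I_q.+3) (j' : 'I_q.+2) :
  i' = j :> nat -> j' = i.-1 :> nat -> (j < i)%N ->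
  face (face t i) j = face (face t i') j'.
Proof.
move=> ei ej lt; have x0 := thead t.
apply: (@eq_face _ _ _ x0) => k kq; rewrite !nth_face // ?/bump; try lia.
by congr nth; rewrite /bump ei ej; lia.
Qed.

Lemma Lambda_bdK q (c : Lambda q) : Lambda_bd q.-1 (Lambda_bd q c) = 0.
Proof.
pose f : {linear Lambda q -> Lambda q.-1.-1} := Lambda_bd q.-1 \o Lambda_bd q.
pose g : {linear Lambda q -> Lambda q.-1.-1} := \0.
suff : f =1 g by apply.
apply: eq_linear_basis => t; rewrite /f /g /= /Lambda_bd linext_basis.
case: q t {f g c} => [|[|q]] t /=; first by rewrite linear0.
  rewrite linear_sum big1 // => i _.
  by rewrite linearZ /= linext_basis scaler0.
rewrite linear_sum /=.
under eq_bigr => i _ do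
  (rewrite linearZ /= linext_basis scaler_sumr;
   under eq_bigr => j _ do rewrite scalerA -exprD).
rewrite pair_big /= (bigID (fun p : 'I_q.+3 * 'I_q.+2 => p.2 < p.1)%N) /=.
pose dn (p : 'I_q.+3 * 'I_q.+2) : 'I_q.+3 * 'I_q.+2 :=
  (widen_ord (leqnSn _) p.2, inord p.1.-1).
pose up (p : 'I_q.+3 * 'I_q.+2) : 'I_q.+3 * 'I_q.+2 :=
  (lift ord0 p.2, inord p.1).
rewrite [X in X + _](reindex_onto up dn) /=; last first.
  move=> [[i iq] [j jq]] /= ji; congr pair; apply/val_inj; last first.
    by rewrite /= inordK.
  rewrite /= /bump leq0n add1n inordK; first by rewrite (ltn_predK ji).
  by case: i ji iq.
rewrite (eq_bigl (fun p : 'I_q.+3 * 'I_q.+2 => ~~ (p.2 < p.1)%N)); last first.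
  move=> [[i iq] [j jq]]; rewrite /up /dn /= /bump leq0n add1n -leqNgt.
  have [ij|ji] := leqP i j.
    have iq2 : (i < q.+2)%N by apply: leq_ltn_trans ij jq.
    rewrite inordK // ltnS ij; apply/eqP; congr pair; apply: val_inj => /=.
      by rewrite inordK.
    by rewrite inordK.
  apply/negbTE/negP => /andP[lt /eqP/(congr1 (fun p => val p.1))/= e].
  by move: lt; rewrite e; lia.
rewrite -big_split big1 //= => -[i j]; rewrite /= -leqNgt => ij.
have e : (inord i : 'I_q.+2) = i :> nat by rewrite inordK // (leq_ltn_trans ij).
rewrite (@face_face _ t (lift ord0 j) (inord i) i j) /= ?e //.
by rewrite /bump leq0n add1n addSn addnC exprS mulN1r scaleNr addNr.
Qed.
End PathComplex.

Section QuotientMap.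
Variables (R : pzRingType) (M M' : lmodType R).
Variables (N : submodule M) (N' : submodule M') (f : {linear M -> M'}).
Hypothesis fN : forall x, x \in smem N -> f x \in smem N'.

Fact qmap_subproof x : x \in smem N -> (qpi N' \o f) x = 0.
Proof.
by move=> xN /=; rewrite -(raddf0 (qpi N')); apply/qpiP; rewrite subr0 fN.
Qed.
Definition qmap : {linear quotm N -> quotm N'} := qlift qmap_subproof.

Lemma qmap_pi x : qmap (qpi N x) = qpi N' (f x).
Proof. exact: (qlift_pi qmap_subproof). Qed.
End QuotientMap.
Arguments qmap : simpl never.

Section RegularPathComplex.
Variables (R : comPzRingType) (V : choiceType).

Fact Lambda_bd_nonreg q (c : Lambda R V q) :
  c \in smem (nonreg R V q) -> Lambda_bd R V q c \in smem (nonreg R V q.-1).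
Proof. by move=> /allP cN; apply: linext_mem => t /cN; apply: epath_bd_nonreg. Qed.

Definition Rpath_bd q : {linear quotm (nonreg R V q) -> quotm (nonreg R V q.-1)} :=
  qmap (@Lambda_bd_nonreg q).

Fact Rpath_bd0 x : Rpath_bd 0 x = 0.
Proof.
rewrite -(qpiK x) /Rpath_bd qmap_pi [Lambda_bd _ _ _ _]big1 ?raddf0 // => t _.
by rewrite scaler0.
Qed.

Fact Rpath_bdK q x : Rpath_bd q.-1 (Rpath_bd q x) = 0.
Proof. by rewrite -(qpiK x) /Rpath_bd !qmap_pi Lambda_bdK raddf0. Qed.

Definition Rpath : chain_complex R :=
  @ChainComplex R (fun q => quotm (nonreg R V q)) Rpath_bd Rpath_bd0 Rpath_bdK.

Definition epath q (t : q.+1.-tuple V) : Rpath q := qpi (nonreg R V q) (fbasis R t).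
End RegularPathComplex.

(* -------------------------------------------------------------------- *)
Section PathMap.
Variables (R : comPzRingType) (V V' : choiceType) (phi : V -> V').

Definition Lambda_map q : {linear Lambda R V q -> Lambda R V' q} :=
  linext (fun t : q.+1.-tuple V => fbasis R (map_tuple phi t)).

Fact Lambda_map_nonreg q (c : Lambda R V q) :
  c \in smem (nonreg R V q) -> Lambda_map q c \in smem (nonreg R V' q).
Proof.
move=> /allP cN; apply: linext_mem => t /cN tN; apply: nonreg_basis.
apply: contra tN; rewrite /regular sorted_map; apply: sub_sorted => x y /=.
by apply: contra_neq => ->.
Qed.

(* A regular path with a non-regular image is sent to 0. *)
Definition Rpath_map q : {linear Rpath R V q -> Rpath R V' q} :=
  qmap (@Lambda_map_nonreg q).
End PathMap.

Section PathReversal.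
Variables (R : comPzRingType) (V : choiceType).

Definition Lambda_rev q : {linear Lambda R V q -> Lambda R V q} :=
  linext (fun t : q.+1.-tuple V => fbasis R (rev_tuple t)).

Lemma Lambda_rev_basis q (t : q.+1.-tuple V) :
  Lambda_rev q (fbasis R t) = fbasis R (rev_tuple t).
Proof. exact: linext_basis. Qed.

Fact Lambda_rev_nonreg q (c : Lambda R V q) :
  c \in smem (nonreg R V q) -> Lambda_rev q c \in smem (nonreg R V q).
Proof.
move=> /allP cN; apply: linext_mem => t /cN tN; apply: nonreg_basis.
rewrite /regular rev_sorted; apply: contra tN; apply: sub_sorted => x y /=.
by rewrite eq_sym.
Qed.

Lemma face_rev q (t : q.+2.-tuple V) i :
  face (rev_tuple t) i = rev_tuple (face t (rev_ord i)).
Proof.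
have x0 := thead t; apply: (@eq_face _ _ _ _ x0) => k kq.
rewrite nth_face //= !nth_rev ?size_tuple ?card_ord //; last by rewrite /bump; lia.
rewrite nth_face; last by lia.
by congr nth; rewrite /bump /=; case: i => /= i iq; lia.
Qed.

Lemma Lambda_bd_rev q (c : Lambda R V q) :
  Lambda_bd R V q (Lambda_rev q c) = (-1) ^+ q *: Lambda_rev q.-1 (Lambda_bd R V q c).
Proof.
pose f : {linear Lambda R V q -> Lambda R V q.-1} :=
  Lambda_bd R V q \o Lambda_rev q.
pose g : {linear Lambda R V q -> Lambda R V q.-1} :=
  (-1) ^+ q \*: (Lambda_rev q.-1 \o Lambda_bd R V q).
suff : f =1 g by apply.
apply: eq_linear_basis => t; rewrite /f /g /= Lambda_rev_basis /Lambda_bd !linext_basis.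
case: q t {f g c} => [|q] t; first by rewrite linear0 scaler0.
rewrite /epath_bd (linear_sum (Lambda_rev q)) scaler_sumr (reindex_inj rev_ord_inj) /=.
apply: eq_bigr => i _; rewrite linearZ /= Lambda_rev_basis face_rev rev_ordK.
rewrite scalerA -exprD; congr (_ *: _); apply/eqP.
rewrite -signr_odd -[in X in _ == X]signr_odd; apply/eqP; congr (_ ^+ _).
congr nat_of_bool; case: i => /= i iq; lia.
Qed.

Definition Rpath_rev q : {linear Rpath R V q -> Rpath R V q} :=
  qmap (@Lambda_rev_nonreg q).

Fact Rpath_revP q x :
  bd (Rpath R V) q (Rpath_rev q x) = (-1) ^+ q *: Rpath_rev q.-1 (bd (Rpath R V) q x).
Proof.
rewrite -(qpiK x) [bd _ _]/(Rpath_bd R V q) /Rpath_rev /Rpath_bd.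
rewrite (qmap_pi (@Lambda_rev_nonreg q)) !(qmap_pi (@Lambda_bd_nonreg R V q)).
by rewrite (qmap_pi (@Lambda_rev_nonreg q.-1)) Lambda_bd_rev linearZ.
Qed.

Definition path_rev : signed_chain_map (Rpath R V) (Rpath R V) :=
  @SignedChainMap R (Rpath R V) (Rpath R V) Rpath_rev id Rpath_revP.

Lemma path_rev_epath q (t : q.+1.-tuple V) :
  path_rev q (epath R t) = epath R (rev_tuple t).
Proof. by rewrite /epath -Lambda_rev_basis; exact: (qmap_pi (@Lambda_rev_nonreg q)). Qed.

Lemma path_revK q : involutive (path_rev q).
Proof.
move=> x; rewrite -(qpiK x); set c := qrepr x.
rewrite [path_rev q]/(Rpath_rev q) /Rpath_rev.
rewrite (qmap_pi _ c) (qmap_pi _ (Lambda_rev q c)); congr qpi.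
pose f : {linear Lambda R V q -> Lambda R V q} := Lambda_rev q \o Lambda_rev q.
suff fE : f =1 (idfun : {linear Lambda R V q -> Lambda R V q}) by exact: (fE c).
apply: eq_linear_basis => t; rewrite /f /= !Lambda_rev_basis.
by congr fbasis; apply: val_inj; rewrite /= revK.
Qed.
End PathReversal.

(* -------------------------------------------------------------------- *)
Record digraph := Digraph {
  vertex :> choiceType;
  arc : rel vertex;
  arc_irr : irreflexive arc }.

(* Values in N with infinity; None is infinity. *)
Definition enat := option nat.
Definition ele (a b : enat) : bool :=
  match a, b with
  | _, None => true
  | None, Some _ => false
  | Some i, Some j => (i <= j)%N
  end.
Definition elt (a b : enat) : bool := ~~ ele b a.
Definition emax (a b : enat) : enat := if ele a b then b else a.

Lemma ele_trans b a c : ele a b -> ele b c -> ele a c.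
Proof. by case: a b c => [a|] [b|] [c|] //=; apply: leq_trans. Qed.

Section Distance.
Variable G : digraph.

Definition dwalk (n : nat) (u v : G) : Prop :=
  exists p : n.-tuple G,
    path (fun x y => arc x y || (x == y)) u p /\ last u p = v.

Definition linked (u v : G) : pred nat :=
  fun n => `[< dwalk n u v \/ dwalk n v u >].

Definition dist (u v : G) : enat :=
  if pselect (exists n, linked u v n) is left ex then Some (ex_minn ex) else None.

Lemma dist_sym u v : dist u v = dist v u.
Proof.
have e : linked u v = linked v u.
  by apply/funext => n; apply: asbool_equiv_eq; split=> -[]; [right|left|right|left].
by rewrite /dist e.
Qed.

Definition pdist k (u v : k.-tuple G) : enat :=
  \big[emax/Some 0%N]_(i < k) dist (tnth u i) (tnth v i).
End Distance.

(* -------------------------------------------------------------------- *)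
(* conf G k n m is the configuration space with parameters n/2 and m/2. *)
Section Conf.
Variables (G : digraph) (k n : nat) (m : enat).

Definition in_range (x y : G) : bool := elt (Some n) (dist x y) && ele (dist x y) m.

Definition conf : Type := {t : k.-tuple G | sorted in_range t}.
HB.instance Definition _ := Choice.on conf.

Definition conf_val (t : conf) : k.-tuple G := val t.
Definition conf_dist (s t : conf) : enat := pdist (conf_val s) (conf_val t).

Fact conf_rev_subproof (t : conf) : sorted in_range (rev_tuple (conf_val t)).
Proof.
rewrite rev_sorted; have := valP t; congr (is_true (sorted _ _)).
by apply/funext => x; apply/funext => y; rewrite /in_range dist_sym.
Qed.
Definition conf_rev (t : conf) : conf := exist _ (rev_tuple (conf_val t)) (conf_rev_subproof t).

Lemma conf_revK : involutive conf_rev.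
Proof. by move=> t; do 2!apply: val_inj; rewrite /= revK. Qed.
End Conf.

Section ConfInclusion.
Variables (G : digraph) (k n n' : nat) (m m' : enat).
Hypotheses (nn' : (n' <= n)%N) (mm' : ele m m').

Fact conf_incl_subproof (t : conf G k n m) : sorted (@in_range G n' m') (conf_val t).
Proof.
apply: sub_sorted (valP t) => x y /andP[nd dm]; apply/andP; split.
  by move: nd; rewrite /elt; case: (dist x y) => //= d; apply: contra => /leq_trans->.
exact: ele_trans dm mm'.
Qed.
Definition conf_incl (t : conf G k n m) : conf G k n' m' :=
  exist _ (conf_val t) (conf_incl_subproof t).
End ConfInclusion.

(* -------------------------------------------------------------------- *)
Section ConfComplex.
Variables (R : comPzRingType) (G : digraph).

Definition DConf_map n m q : {linear freemod R (conf G q.+1 n m) -> Rpath R G q} :=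
  linext (fun t : conf G q.+1 n m => epath R (conf_val t)).

Fact DConf_closed n m q : submod_closed [pred x | `[< exists c, DConf_map n m q c = x >]].
Proof.
split=> [|a x y]; rewrite !inE; first by apply/asboolP; exists 0; rewrite linear0.
move=> /asboolP[c cx] /asboolP[d dy]; apply/asboolP; exists (a *: c + d).
by rewrite linearP cx dy.
Qed.
Definition DConf n m : graded_submodule (Rpath R G) := fun q => Submodule (@DConf_closed n m q).

Definition HD n m q : lmodType R := homology (Inf (DConf n m)) q.

Lemma DConf_image n m n' m' q (f : {linear Rpath R G q -> Rpath R G q})
    (g : conf G q.+1 n m -> conf G q.+1 n' m') :
  (forall t, f (epath R (conf_val t)) = epath R (conf_val (g t))) ->
  forall x, x \in smem (DConf n m q) -> f x \in smem (DConf n' m' q).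
Proof.
move=> fg x; rewrite !inE => /asboolP[c <-]; apply/asboolP.
exists (linext (fun t => fbasis R (g t)) c).
pose f1 : {linear freemod R (conf G q.+1 n m) -> Rpath R G q} :=
  DConf_map n' m' q \o linext (fun t => fbasis R (g t)).
pose f2 : {linear freemod R (conf G q.+1 n m) -> Rpath R G q} := f \o DConf_map n m q.
suff : f1 =1 f2 by apply.
by apply: eq_linear_basis => t; rewrite /f1 /f2 /= /DConf_map !linext_basis fg.
Qed.

Fact path_rev_DConf n m q x :
  x \in smem (DConf n m q) -> path_rev R G q x \in smem (DConf n m q).
Proof.
by apply: (DConf_image (g := @conf_rev G _ n m)) => t; rewrite path_rev_epath.
Qed.

Definition HD_rev n m q : {linear HD n m q -> HD n m q} :=
  hmap (inf_map (@path_rev_DConf n m)) q.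

Lemma HD_revK n m q : involutive (HD_rev n m q).
Proof.
move=> x; rewrite -(qpiK x); set z := qrepr x.
pose f := inf_map (@path_rev_DConf n m).
rewrite /HD_rev -/f (hmap_class f z) (hmap_class f (cyc_map f z)).
suff -> : cyc_map f (cyc_map f z) = z by [].
apply/val_inj/val_inj; exact: (path_revK (val (val z))).
Qed.

Fact path_id_subproof q (x : Rpath R G q) :
  bd (Rpath R G) q (idfun x) = (-1) ^+ 0 *: idfun (bd (Rpath R G) q x).
Proof. by rewrite expr0 scale1r. Qed.
Definition path_id : signed_chain_map (Rpath R G) (Rpath R G) :=
  @SignedChainMap R (Rpath R G) (Rpath R G) (fun=> idfun) (fun=> 0%N) path_id_subproof.

Section Inclusion.
Variables (n n' : nat) (m m' : enat).
Hypotheses (nn' : (n' <= n)%N) (mm' : ele m m').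

Fact DConf_incl q x : x \in smem (DConf n m q) -> path_id q x \in smem (DConf n' m' q).
Proof. exact: (DConf_image (g := conf_incl nn' mm')). Qed.

Definition HD_incl q : {linear HD n m q -> HD n' m' q} := hmap (inf_map DConf_incl) q.
End Inclusion.
End ConfComplex.

(* -------------------------------------------------------------------- *)
Section Morphisms.
Variables (G G' : digraph) (phi : G -> G').

Definition dmorphism : Prop :=
  forall u v, arc u v -> arc (phi u) (phi v) \/ phi u = phi v.

Definition strong_tg_embedding : Prop :=
  dmorphism /\ forall u v, dist u v = dist (phi u) (phi v).

(* radius m0/2 *)
Definition strong_tg_immersion (m0 : nat) : Prop :=
  dmorphism /\
  forall u v, ele (dist u v) (Some m0) -> dist u v = dist (phi u) (phi v).

Definition isometric_embedding k n m (f : conf G k n m -> conf G' k n m) : Prop :=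
  injective f /\ forall s t, conf_dist (f s) (f t) = conf_dist s t.

(* Injectivity and preservation of the distance for the pairs at distance at
   most m0, as for immersions of digraphs with radius m0/2. *)
Definition isometric_embedding_within (m0 : nat) k n m
    (f : conf G k n m -> conf G' k n m) : Prop :=
  forall s t, ele (conf_dist s t) (Some m0) ->
    (f s = f t -> s = t) /\ conf_dist (f s) (f t) = conf_dist s t.
End Morphisms.

(* The parameters (n/2, m/2) with 1 <= n < m <= M. *)
Record scale (M : enat) := Scale {
  sn : nat;
  sm : enat;
  scaleP : [&& (1 <= sn)%N, elt (Some sn) sm & ele sm M] }.

Section Families.
Variables (G G' : digraph) (phi : G -> G') (M : enat).

Definition conf_family :=
  forall k (s : scale M), conf G k.+1 (sn s) (sm s) -> conf G' k.+1 (sn s) (sm s).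

Definition tuplewise (f : conf_family) : Prop :=
  forall k s t, conf_val (f k s t) = map_tuple phi (conf_val t).

Definition conf_equivariant (f : conf_family) : Prop :=
  forall k s t, f k s (conf_rev t) = conf_rev (f k s t).

Definition conf_persistent (f : conf_family) : Prop :=
  forall k s s' (le_n : (sn s' <= sn s)%N) (le_m : ele (sm s) (sm s')) t,
    f k s' (conf_incl le_n le_m t) = conf_incl le_n le_m (f k s t).

Variable R : comPzRingType.

Definition HD_family :=
  forall (s : scale M) q,
    {linear HD R G (sn s) (sm s) q -> HD R G' (sn s) (sm s) q}.

Definition induced_by_path_map (h : HD_family) : Prop :=
  forall s q (z : subm (cycles (Inf (DConf R G (sn s) (sm s))) q)),
  exists z' : subm (cycles (Inf (DConf R G' (sn s) (sm s))) q),
    val (val z') = Rpath_map R phi q (val (val z)) /\ h s q (hclass z) = hclass z'.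

Definition HD_equivariant (h : HD_family) : Prop :=
  forall s q x, h s q (HD_rev R G _ _ q x) = HD_rev R G' _ _ q (h s q x).

Definition HD_persistent (h : HD_family) : Prop :=
  forall s s' q (le_n : (sn s' <= sn s)%N) (le_m : ele (sm s) (sm s')) x,
    h s' q (HD_incl R G le_n le_m q x) = HD_incl R G' le_n le_m q (h s q x).
End Families.

(* Main.v *)
Require Import Defs.
From mathcomp Require Import all_boot all_algebra.
From mathcomp Require Import boolp.

Set Implicit Arguments.
Unset Strict Implicit.
Unset Printing Implicit Defensive.

Import GRing.Theory.
Local Open Scope ring_scope.

(** The bound [m <= M] makes [phi] preserve every distance that enters the
    definition of a configuration space, so [phi] acts on tuples coordinatewise.
    Deleting an entry commutes with applying [phi], hence the linear extension
    is a chain map of regular path complexes; it sends [D] to [D'] and therefore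
    [Inf D] to [Inf D']. Equivariance and persistence already hold for the
    underlying chains. *)

Section ExtendedNaturals.
Implicit Types a b c : enat.

(** The order [ele] is total, so [emax] is whichever argument dominates, and transitivity carries
    the bound over to the other one. *)
Lemma ele_emax a b c : ele (emax a b) c = ele a c && ele b c.
Proof.
rewrite /emax; case: ifP => ab.
  by apply/idP/andP => [bc|[]//]; split=> //; apply: ele_trans ab bc.
have ba : ele b a.
  by move: ab; case: a b => [i|] [j|] //= /negbT; rewrite -ltnNge => /ltnW.
by apply/idP/andP => [ac|[]//]; split=> //; apply: ele_trans ba ac.
Qed.

Lemma ele0 a : ele (Some 0%N) a.
Proof. by case: a. Qed.

(** Used to split a bound on the product distance into bounds on coordinates. The initial value
    [Some 0] lies below every [c], so it adds no constraint. *)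
Lemma ele_bigemax (I : finType) (F : I -> enat) c :
  reflect (forall i, ele (F i) c) (ele (\big[emax/Some 0%N]_i F i) c).
Proof.
suff -> : ele (\big[emax/Some 0%N]_i F i) c = all (fun i => ele (F i) c) (index_enum I).
  by apply: (iffP allP) => H i *; apply: H; rewrite ?mem_index_enum.
by elim: (index_enum I) => [|i r IH]; rewrite ?big_nil ?ele0 // big_cons ele_emax IH.
Qed.
End ExtendedNaturals.

Section DistanceZero.
Variable G : digraph.
Implicit Types u v : G.

Lemma dist_refl u : dist u u = Some 0%N.
Proof.
rewrite /dist; case: pselect => [ex|[]]; last first.
  by exists 0%N; apply/asboolP; left; exists [tuple].
congr Some; apply/eqP; rewrite -leqn0; case: ex_minnP => n _; apply.
by apply/asboolP; left; exists [tuple].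
Qed.

(** The minimum is attained, and a walk with no steps ends where it starts. This is how preservation
    of distances will give injectivity. *)
Lemma dist_eq0 u v : dist u v = Some 0%N -> u = v.
Proof.
rewrite /dist; case: pselect => // ex [].
case: ex_minnP => n /asboolP uv _ n0; move: uv; rewrite n0.
by move=> [] [p []]; rewrite (tuple0 p).
Qed.
End DistanceZero.

Section TupleMap.
Variables (V V' : choiceType) (phi : V -> V').

Lemma face_map q (t : q.+2.-tuple V) i :
  face (map_tuple phi t) i = map_tuple phi (face t i).
Proof. by apply/eq_from_tnth => j; rewrite !(tnth_mktuple, tnth_map). Qed.

Lemma rev_map_tuple q (t : q.-tuple V) :
  map_tuple phi (rev_tuple t) = rev_tuple (map_tuple phi t).
Proof. by apply: val_inj; rewrite /= map_rev. Qed.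
End TupleMap.

Section PathMap.
Variables (R : comPzRingType) (V V' : choiceType) (phi : V -> V').

Lemma Lambda_map_basis q (t : q.+1.-tuple V) :
  Lambda_map R phi q (fbasis R t) = fbasis R (map_tuple phi t).
Proof. exact: linext_basis. Qed.

Lemma Lambda_bd_map q (c : Lambda R V q) :
  Lambda_bd R V' q (Lambda_map R phi q c) = Lambda_map R phi q.-1 (Lambda_bd R V q c).
Proof.
pose f : {linear Lambda R V q -> Lambda R V' q.-1} :=
  Lambda_bd R V' q \o Lambda_map R phi q.
pose g : {linear Lambda R V q -> Lambda R V' q.-1} :=
  Lambda_map R phi q.-1 \o Lambda_bd R V q.
suff : f =1 g by apply.
apply: eq_linear_basis => t.
rewrite /f /g /= Lambda_map_basis /Lambda_bd !linext_basis.
(* In degree 0 the boundary vanishes by definition; in positive degree the two alternating sums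
   agree face by face. *)
case: q t {f g c} => [|q] t; first by rewrite linear0.
rewrite /epath_bd (linear_sum (Lambda_map R phi q)).
by apply: eq_bigr => i _; rewrite linearZ /= Lambda_map_basis face_map.
Qed.

Lemma Lambda_map_rev q (c : Lambda R V q) :
  Lambda_map R phi q (Lambda_rev R V q c) = Lambda_rev R V' q (Lambda_map R phi q c).
Proof.
pose f : {linear Lambda R V q -> Lambda R V' q} :=
  Lambda_map R phi q \o Lambda_rev R V q.
pose g : {linear Lambda R V q -> Lambda R V' q} :=
  Lambda_rev R V' q \o Lambda_map R phi q.
suff : f =1 g by apply.
apply: eq_linear_basis => t.
by rewrite /f /g /= !(Lambda_rev_basis, Lambda_map_basis) rev_map_tuple.
Qed.

Lemma Rpath_map_pi q (c : Lambda R V q) :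
  Rpath_map R phi q (qpi (nonreg R V q) c) = qpi (nonreg R V' q) (Lambda_map R phi q c).
Proof. exact: (qmap_pi (@Lambda_map_nonreg R V V' phi q)). Qed.

Lemma Rpath_map_epath q (t : q.+1.-tuple V) :
  Rpath_map R phi q (epath R t) = epath R (map_tuple phi t).
Proof. by rewrite /epath Rpath_map_pi Lambda_map_basis. Qed.

Lemma Rpath_map_rev q (x : Rpath R V q) :
  Rpath_map R phi q (path_rev R V q x) = path_rev R V' q (Rpath_map R phi q x).
Proof.
rewrite -(qpiK x) Rpath_map_pi.
rewrite [path_rev R V q]/(Rpath_rev R V q) [path_rev R V' q]/(Rpath_rev R V' q).
rewrite (qmap_pi (@Lambda_rev_nonreg R V q)) (qmap_pi (@Lambda_rev_nonreg R V' q)).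
by rewrite Rpath_map_pi Lambda_map_rev.
Qed.

(** The factor [(-1) ^+ 0] matches the form of [cmapP] with zero sign exponent, that is, an ordinary
    chain map. *)
Lemma Rpath_mapP q (x : Rpath R V q) :
  bd (Rpath R V') q (Rpath_map R phi q x) =
  (-1) ^+ 0 *: Rpath_map R phi q.-1 (bd (Rpath R V) q x).
Proof.
rewrite expr0 scale1r -(qpiK x) Rpath_map_pi.
rewrite [bd (Rpath R V') q]/(Rpath_bd R V' q) [bd (Rpath R V) q]/(Rpath_bd R V q).
rewrite (qmap_pi (@Lambda_bd_nonreg R V q)) (qmap_pi (@Lambda_bd_nonreg R V' q)).
by rewrite Rpath_map_pi Lambda_bd_map.
Qed.

Definition path_map : signed_chain_map (Rpath R V) (Rpath R V') :=
  @SignedChainMap R (Rpath R V) (Rpath R V') (Rpath_map R phi) (fun=> 0%N) Rpath_mapP.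
End PathMap.

Section InducedSquare.
Variables (R : pzRingType) (A B C D : chain_complex R).
Variables (f : signed_chain_map A B) (g : signed_chain_map B D).
Variables (h : signed_chain_map A C) (k : signed_chain_map C D).

(** Equivariance and persistence on homology are both squares of this kind. Since the square
    commutes strictly on chains, the two image cycles are equal, not merely homologous. *)
Lemma hmap_square q :
  (forall x, g q (f q x) = k q (h q x)) ->
  forall x, hmap g q (hmap f q x) = hmap k q (hmap h q x).
Proof.
move=> gfkh x; rewrite -(qpiK x); set z := qrepr x.
rewrite (hmap_class f z) (hmap_class h z) !hmap_class; congr hclass.
by apply: val_inj; rewrite /= gfkh.
Qed.
End InducedSquare.

Section ConfMap.
Variables (G G' : digraph) (phi : G -> G') (M : enat).
Hypothesis phiM :
  forall u v, ele (dist u v) M -> dist u v = dist (phi u) (phi v).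

(** Consecutive entries are at distance at most [sm s], hence at most [M], so [phi] preserves that
    distance and with it both range conditions. *)
Fact conf_map_subproof k (s : scale M) (t : conf G k (sn s) (sm s)) :
  sorted (@in_range G' (sn s) (sm s)) (map_tuple phi (conf_val t)).
Proof.
rewrite sorted_map; apply: sub_sorted (valP t) => x y /andP[nd dm].
have /and3P[_ _ mM] := scaleP s.
by rewrite /= /in_range -phiM ?nd // (ele_trans dm mM).
Qed.

Definition conf_map : conf_family G G' M :=
  fun k s t => exist _ (map_tuple phi (conf_val t)) (conf_map_subproof t).

Lemma conf_map_equivariant : conf_equivariant conf_map.
Proof. by move=> k s t; apply: val_inj; rewrite /= rev_map_tuple. Qed.

Lemma conf_map_persistent : conf_persistent conf_map.
Proof. by move=> k s s' le_n le_m t; apply: val_inj. Qed.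

(** With [M = Some m0] this is the local statement for immersions; with [M = None] the bound always
    holds and the statement becomes global. *)
Lemma conf_map_isometric k (s : scale M) (t u : conf G k.+1 (sn s) (sm s)) :
  ele (conf_dist t u) M ->
  (conf_map t = conf_map u -> t = u) /\
  conf_dist (conf_map t) (conf_map u) = conf_dist t u.
Proof.
move/ele_bigemax => tuM; split=> [tu|]; last first.
  by apply: eq_bigr => i _; rewrite !tnth_map -phiM.
(* Equal images have coordinates at distance 0 in [G'], and [phiM] pulls this back to [G]. *)
apply: val_inj; apply: eq_from_tnth => i; apply: dist_eq0.
rewrite phiM // -!(tnth_map phi).
by move: (congr1 (fun w => tnth (conf_val w) i) tu) => /= ->; rewrite dist_refl.
Qed.

Variable R : comPzRingType.

Lemma path_map_DConf (s : scale M) q x :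
  x \in smem (DConf R G (sn s) (sm s) q) ->
  path_map R phi q x \in smem (DConf R G' (sn s) (sm s) q).
Proof.
rewrite !inE => /asboolP[c <-]; apply/asboolP.
(* The preimage is the linear extension of [conf_map] applied to [c]; on a single configuration both
   routes give the path of its image tuple. *)
exists (linext (fun t => fbasis R (conf_map t)) c).
pose f : {linear freemod R (conf G q.+1 (sn s) (sm s)) -> Rpath R G' q} :=
  DConf_map R G' (sn s) (sm s) q \o linext (fun t => fbasis R (conf_map t)).
pose g : {linear freemod R (conf G q.+1 (sn s) (sm s)) -> Rpath R G' q} :=
  Rpath_map R phi q \o DConf_map R G (sn s) (sm s) q.
suff : f =1 g by apply.
apply: eq_linear_basis => t.
rewrite /f /g /= /DConf_map !linext_basis.
exact/esym/(Rpath_map_epath R phi (conf_val t)).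
Qed.

Definition HD_map : HD_family G G' M R :=
  fun s q => hmap (inf_map (@path_map_DConf s)) q.

Lemma HD_map_induced : induced_by_path_map phi HD_map.
Proof.
by move=> s q z; exists (cyc_map (inf_map (@path_map_DConf s)) z); rewrite -hmap_class.
Qed.

Lemma HD_map_equivariant : HD_equivariant HD_map.
Proof.
by move=> s q x; apply: hmap_square => y; apply: val_inj; apply: Rpath_map_rev.
Qed.

Lemma HD_map_persistent : HD_persistent HD_map.
(* The inclusions are the identity on underlying paths, so both composites have the same value. *)
Proof. by move=> s s' q le_n le_m x; apply: hmap_square => y; apply: val_inj. Qed.
End ConfMap.

Theorem theorem1p5 (R : comPzRingType) (G G' : digraph) (phi : G -> G') :
  (forall m0 : nat, strong_tg_immersion phi m0 ->
     (exists f : conf_family G G' (Some m0),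
        [/\ tuplewise phi f, conf_equivariant f, conf_persistent f &
            forall k s, isometric_embedding_within m0 (f k s)]) /\
     (exists h : HD_family G G' (Some m0) R,
        [/\ induced_by_path_map phi h, HD_equivariant h & HD_persistent h]))
  /\
  (strong_tg_embedding phi ->
     (exists f : conf_family G G' None,
        [/\ tuplewise phi f, conf_equivariant f, conf_persistent f &
            forall k s, isometric_embedding (f k s)]) /\
     (exists h : HD_family G G' None R,
        [/\ induced_by_path_map phi h, HD_equivariant h & HD_persistent h])).
Proof.
split=> [m0 [_ phiM]|[_ phi_dist]].
  split; [exists (conf_map phiM)|exists (HD_map phiM R)].
    split=> //; [exact: conf_map_equivariant|exact: conf_map_persistent|].
    by move=> k s t u; apply: conf_map_isometric.
  split; [exact: HD_map_induced|exact: HD_map_equivariant|exact: HD_map_persistent].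
(* An embedding is treated as the case [M = None] of the same construction. *)
have phiM u v : ele (dist u v) None -> dist u v = dist (phi u) (phi v) by [].
have ele_top a : ele a None by case: a.
split; [exists (conf_map phiM)|exists (HD_map phiM R)].
  split=> //; [exact: conf_map_equivariant|exact: conf_map_persistent|].
  by move=> k s; split=> t u; have [] := conf_map_isometric phiM (ele_top (conf_dist t u)).
split; [exact: HD_map_induced|exact: HD_map_equivariant|exact: HD_map_persistent].
Qed.
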